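(* Let $A\in M_{n\times m}(\mathbb{T})$ have full row rank and let $H=H_A$ be its $\mathcal{H}$-class in $M(\mathbb{T})$. Then the map $$\gamma\colon G_A\to\Gamma_H,\qquad \gamma(P)=\phi_P$$ is a group isomorphism.
   Context: $\mathbb{T} = \mathbb{R}\cup\{-\infty\}$ is the tropical semiring, with $\oplus = \max$ and $\otimes = +$. $M(\mathbb{T})$ is the category of all matrices of any (positive) size over $\mathbb{T}$, with tropical matrix multiplication whenever sizes are compatible; $M_{n\times m}(\mathbb{T})$ is the set of $n\times m$ matrices and $M_n(\mathbb{T})=M_{n\times n}(\mathbb{T})$. The row space $R(A)\subseteq\mathbb{T}^m$ of $A\in M_{n\times m}(\mathbb{T})$ is the $\mathbb{T}$-subsemimodule generated by the rows of $A$. The row rank of $A$ is the minimum cardinality of a generating set of $R(A)$ (under tropical addition and scaling); $A$ has full row rank if its row rank is $n$. Write $S=M(\mathbb{T})$. For $a,b\in S$: $a\mathrel{\mathcal{R}}b$ if $aS=bS$, $a\mathrel{\mathcal{L}}b$ if $Sa=Sb$ (all products that are defined), and $a\mathrel{\mathcal{H}}b$ if both hold. $H_a$ is the $\mathcal{H}$-class of $a$. For an $\mathcal{H}$-class $H$ and $s\in S$ such that $sh$ is defined for all $h\in H$ and $sH\subseteq H$, let $\phi_s\colon H\to H$, $a\mapsto sa$. The (left) Schützenberger group of $H$ is $\Gamma_H=\{\phi_s : s\in S,\ sH\subseteq H\}$, a group under composition. A unit of $M_n(\mathbb{T})$ is an invertible matrix, equivalently a monomial matrix (exactly one entry different from $-\infty$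 in each row and each column). For $A\in M_{n\times m}(\mathbb{T})$, $G_A$ is the group (under tropical matrix multiplication) of all units $P\in M_n(\mathbb{T})$ such that $PX\in H_A$ for all $X\in H_A$; equivalently, $PA\in H_A$. *)

(* Defs.v *)
From HB Require Import structures.
From mathcomp Require Import all_boot all_order all_algebra.
From mathcomp Require Import boolp classical_sets functions cardinality reals.

Set Implicit Arguments.
Unset Strict Implicit.
Unset Printing Implicit Defensive.

Import Order.TTheory GRing.Theory Num.Theory.
Local Open Scope classical_set_scope.
Local Open Scope card_scope.
Local Open Scope ring_scope.

(* [None] is -oo, [Some x] is the real number x. *)
Definition tropical (R : realType) : Type := option R.

Section Tropical.
Variable R : realType.
Local Notation T := (tropical R).

HB.instance Definition _ := Choice.on T.

Definition trop_add (x y : T) : T :=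
  match x, y with
  | None, _ => y
  | _, None => x
  | Some a, Some b => Some (Num.max a b)
  end.

Definition trop_mul (x y : T) : T :=
  match x, y with
  | Some a, Some b => Some (a + b)
  | _, _ => None
  end.

Fact trop_addA : associative trop_add.
Proof. by move=> [a|] [b|] [c|] //=; rewrite maxA. Qed.

Fact trop_addC : commutative trop_add.
Proof. by move=> [a|] [b|] //=; rewrite maxC. Qed.

Fact trop_add0 : left_id None trop_add.
Proof. by []. Qed.

HB.instance Definition _ := GRing.isNmodule.Build T trop_addA trop_addC trop_add0.

Fact trop_mulA : associative trop_mul.
Proof. by move=> [a|] [b|] [c|] //=; rewrite addrA. Qed.

Fact trop_mulC : commutative trop_mul.
Proof. by move=> [a|] [b|] //=; rewrite addrC. Qed.

Fact trop_mul1 : left_id (Some 0) trop_mul.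
Proof. by move=> [a|] //=; rewrite add0r. Qed.

Fact trop_mulDl : left_distributive trop_mul trop_add.
Proof. by move=> [a|] [b|] [c|] //=; rewrite addr_maxl. Qed.

Fact trop_mul0 : left_zero None trop_mul.
Proof. by []. Qed.

Fact trop_1neq0 : Some 0 != None :> T.
Proof. by []. Qed.

HB.instance Definition _ := GRing.Nmodule_isComNzSemiRing.Build T
  trop_mulA trop_mulC trop_mul1 trop_mulDl trop_mul0 trop_1neq0.

End Tropical.

Section RowRank.
Variable R : realType.
Local Notation T := (tropical R).

Definition span k (G : set 'rV[T]_k) : set 'rV[T]_k :=
  smallest [set V : set 'rV[T]_k | GRing.subsemimod_closed [in V]] G.

Definition row_space n m (A : 'M[T]_(n, m)) : set 'rV[T]_m :=
  span [set row i A | i in [set: 'I_n]].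

(* Generating sets range over all sets of vectors, finite or not. *)
Definition is_row_rank n m (A : 'M[T]_(n, m)) (k : nat) : Prop :=
  (exists2 G : set 'rV[T]_m, span G = row_space A & G #= `I_k) /\
  (forall G : set 'rV[T]_m, span G = row_space A -> `I_k #<= G).

Definition full_row_rank n m (A : 'M[T]_(n, m)) : Prop := is_row_rank A n.

Definition invertible_mx n (P : 'M[T]_n) : Prop :=
  exists Q : 'M[T]_n, P *m Q = 1%:M /\ Q *m P = 1%:M.

End RowRank.

(* The category M(T): the pair of indices (n, m) stands for the positive size
   n.+1 x m.+1. *)
Definition tmat (R : realType) : Type :=
  {d : nat * nat & 'M[tropical R]_(d.1.+1, d.2.+1)}.

Section Category.
Variable R : realType.
Local Notation T := (tropical R).
Local Notation M := (tmat R).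

HB.instance Definition _ := Choice.on M.

Definition Mat n m (A : 'M[T]_(n.+1, m.+1)) : M :=
  existT (fun d : nat * nat => 'M[T]_(d.1.+1, d.2.+1)) (n, m) A.

(* [None] when the sizes are not compatible. *)
Definition tmul (a b : M) : option M :=
  match (tag a).2 =P (tag b).1 with
  | ReflectT e =>
      Some (Mat (castmx (erefl, congr1 S e) (tagged a) *m tagged b))
  | ReflectF _ => None
  end.

Definition right_ideal (a : M) : set M :=
  [set c | exists x, tmul a x = Some c].

Definition left_ideal (a : M) : set M :=
  [set c | exists x, tmul x a = Some c].

Definition greenR (a b : M) : Prop := right_ideal a = right_ideal b.
Definition greenL (a b : M) : Prop := left_ideal a = left_ideal b.
Definition greenH (a b : M) : Prop := greenR a b /\ greenL a b.

Definition Hclass (a : M) : set M := [set b | greenH a b].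

Definition stabilizes (H : set M) (s : M) : Prop :=
  forall h, H h -> exists2 c, tmul s h = Some c & H c.

(* Total extension of h |-> sh; the default value h is only used when
   s does not stabilize H. *)
Definition phi (H : set M) (s : M) (h : H) : H :=
  insubd h (odflt (val h) (tmul s (val h))).

Fact tmul_Mat n m p (A : 'M[T]_(n.+1, m.+1)) (B : 'M[T]_(m.+1, p.+1)) :
  tmul (Mat A) (Mat B) = Some (Mat (A *m B)).
Proof.
rewrite /tmul; case: eqP => //= e.
by rewrite (eq_irrelevance (congr1 S e) erefl) castmx_id.
Qed.

Fact tmulP (a b c : M) : tmul a b = Some c ->
  exists n m p (A : 'M[T]_(n.+1, m.+1)) (B : 'M[T]_(m.+1, p.+1)),
    [/\ a = Mat A, b = Mat B & c = Mat (A *m B)].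
Proof.
case: a b => [[n m] A] [[m' p] B] /= ab.
case: (m =P m') => [e|ne]; last by move: ab; rewrite /tmul; case: eqP.
subst m'; exists n, m, p, A, B; split => //.
by move: ab; rewrite [LHS](tmul_Mat A B) => -[].
Qed.

Fact Mat_inj n m : injective (@Mat n m).
Proof. by move=> A B /eqP; rewrite eq_Tagged /= => /eqP. Qed.

Fact tmulA (a b c ab : M) : tmul a b = Some ab ->
  tmul ab c = obind (tmul a) (tmul b c).
Proof.
move=> /tmulP[n [m [p [A [B [-> -> ->]]]]]].
case: c => -[p' q] C; case: (p =P p') => [e|ne]; last first.
  by rewrite /tmul /=; case: eqP => // ?; case: eqP.
by subst p'; rewrite [LHS](tmul_Mat _ C) (tmul_Mat B C) /= tmul_Mat mulmxA.
Qed.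

Fact tmulAb (a b c ab bc : M) : tmul a b = Some ab -> tmul b c = Some bc ->
  tmul ab c = tmul a bc.
Proof. by move=> /tmulA -> ->. Qed.

Definition tid n : M := Mat (1%:M : 'M[T]_n.+1).

Fact tmul1r (a : M) : tmul a (tid (tag a).2) = Some a.
Proof. by case: a => [[n m] A]; rewrite [LHS]tmul_Mat mulmx1. Qed.

Fact tmul1l (a : M) : tmul (tid (tag a).1) a = Some a.
Proof. by case: a => [[n m] A]; rewrite [LHS]tmul_Mat mul1mx. Qed.

Fact greenR_sub (a b : M) :
  (exists x, tmul a x = Some b) -> right_ideal b `<=` right_ideal a.
Proof.
move=> [x ax] c [y bY]; have := tmulA y ax; rewrite bY.
by case xy: (tmul x y) => [z|] //= az; exists z.
Qed.

Fact greenL_sub (a b : M) :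
  (exists x, tmul x a = Some b) -> left_ideal b `<=` left_ideal a.
Proof.
move=> [x xa] c [y yb]; case: (tmulP yb) => n [m [p [Y [B [ey eb _]]]]].
case: (tmulP xa) => n' [m' [p' [X [A [ex ea eb']]]]].
move: eb'; rewrite eb => /(congr1 (fun u : M => (tag u).1)) /= en.
subst n'; exists (Mat (Y *m X)); rewrite -yb ey.
have YX : tmul (Mat Y) (Mat X) = Some (Mat (Y *m X)) by rewrite tmul_Mat.
by rewrite (tmulA _ YX) -ex xa.
Qed.

Fact greenRP (a b : M) :
  greenR a b <->
  (exists x, tmul a x = Some b) /\ (exists x, tmul b x = Some a).
Proof.
split=> [ab|[ab ba]]; last by apply/seteqP; split; exact: greenR_sub.
have aa : right_ideal a a by exists (tid (tag a).2); exact: tmul1r.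
have bb : right_ideal b b by exists (tid (tag b).2); exact: tmul1r.
by split; [rewrite -ab in bb | rewrite ab in aa].
Qed.

Fact greenLP (a b : M) :
  greenL a b <->
  (exists x, tmul x a = Some b) /\ (exists x, tmul x b = Some a).
Proof.
split=> [ab|[ab ba]]; last by apply/seteqP; split; exact: greenL_sub.
have aa : left_ideal a a by exists (tid (tag a).1); exact: tmul1l.
have bb : left_ideal b b by exists (tid (tag b).1); exact: tmul1l.
by split; [rewrite -ab in bb | rewrite ab in aa].
Qed.

Fact Hclass_refl a : Hclass a a. Proof. by []. Qed.

Fact phiE (H : set M) s (h : H) :
  stabilizes H s -> tmul s (val h) = Some (val (phi s h)).
Proof.
move=> /(_ (val h) (set_mem (valP h)))[c sh Hc].
by rewrite /phi sh /= insubdK //; exact/mem_set.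
Qed.

(* If t undoes s on the generator a, it undoes s on the whole H-class. *)
Fact stabilizes_inv (a s t sa : M) :
  stabilizes (Hclass a) s -> tmul s a = Some sa -> tmul t sa = Some a ->
  [/\ stabilizes (Hclass a) t,
      forall x y, Hclass a x -> tmul s x = Some y -> tmul t y = Some x &
      forall x y, Hclass a y -> tmul t y = Some x -> tmul s x = Some y].
Proof.
move=> sH sa_def tsa.
have Hsa : Hclass a sa by have [c] := sH a (Hclass_refl a); rewrite sa_def => -[<-].
have undo x y : Hclass a x -> tmul s x = Some y -> tmul t y = Some x.
  move=> [/greenRP[[z az] _] _] sx.
  by rewrite -(tmulAb sa_def az) in sx; rewrite -(tmulAb tsa sx).
have redo y : Hclass a y -> exists x,
    [/\ tmul t y = Some x, tmul s x = Some y & Hclass a x].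
  move=> Hy.
  have saRy : greenR sa y by rewrite /greenR -Hsa.1 Hy.1.
  have [[z saz] [w yw]] := (greenRP sa y).1 saRy.
  have [x az] : exists x, tmul a z = Some x.
    have := tmulA z sa_def; rewrite saz.
    by case: (tmul a z) => [x|] // _; exists x.
  have sx : tmul s x = Some y by rewrite -(tmulAb sa_def az).
  have ty : tmul t y = Some x by rewrite -(tmulAb tsa saz).
  exists x; split => //; split.
  - apply/greenRP; split; first by exists z.
    by exists w; rewrite (tmulAb ty yw).
  - rewrite /greenL Hy.2; apply/greenLP.
    by split; [exists t | exists s].
split=> // [y Hy|x y Hy].
  by have [x [ty _ Hx]] := redo y Hy; exists x.
by have [x' [-> sx _]] := redo y Hy => -[<-].
Qed.

Fact stabilizes_comp (H : set M) (s t st : M) :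
  tmul s t = Some st -> stabilizes H s -> stabilizes H t -> stabilizes H st.
Proof.
move=> st_def sH tH h /tH[c th /sH[d sc Hd]].
by exists d => //; rewrite (tmulAb st_def th).
Qed.

Fact stabilizes_tid n m (A : 'M[T]_(n.+1, m.+1)) :
  stabilizes (Hclass (Mat A)) (tid n).
Proof.
move=> h Hh; exists h => //.
have [[x /tmulP[n' [m' [p [A' [X [eA _ eh]]]]]]] _] := (greenRP _ _).1 Hh.1.
have := congr1 (fun u : M => (tag u).1) eA => /= e; subst n'.
by rewrite eh tmul_Mat mul1mx.
Qed.

End Category.

Section SchutzenbergerGroup.
Variables (R : realType) (a : tmat R).
Local Notation H := (Hclass a).

Definition Gamma_set : set (H -> H) :=
  [set @phi R H s | s in [set s | stabilizes H s]].

Definition Gamma : Type := Gamma_set.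

HB.instance Definition _ := Choice.on Gamma.

Fact Gamma_setP (f : H -> H) :
  Gamma_set f <-> exists s, forall h : H, tmul s (val h) = Some (val (f h)).
Proof.
split=> [[s sH <-]|[s sf]]; first by exists s => h; rewrite (phiE h sH).
have sH : stabilizes H s.
  move=> h Hh; have := sf (SigSub (mem_set Hh)) => /= E.
  by exists (val (f (SigSub (mem_set Hh)))) => //; exact: set_mem (valP _).
exists s => //; apply/funext => h; apply/val_inj.
by have := phiE h sH; rewrite sf => -[].
Qed.

Fact Gamma_set_comp (f g : H -> H) :
  Gamma_set f -> Gamma_set g -> Gamma_set (f \o g).
Proof.
move=> /Gamma_setP[s sf] /Gamma_setP[t tg]; apply/Gamma_setP.
pose ha : H := SigSub (mem_set (Hclass_refl a)).
have [st st_def] : exists st, tmul s t = Some st.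
  have [n [m [p [S [B [eS eB _]]]]]] := tmulP (sf (g ha)).
  have [n' [m' [p' [U [C [eU _ eg]]]]]] := tmulP (tg ha).
  move: eg; rewrite eB => /(congr1 (fun u : tmat R => (tag u).1)) /= e.
  by subst n'; exists (Mat (S *m U)); rewrite eS eU tmul_Mat.
by exists st => h; rewrite (tmulAb st_def (tg h)) sf.
Qed.

Fact Gamma_set_id : Gamma_set id.
Proof.
apply/Gamma_setP; exists (tid R (tag a).1) => h.
have sH : stabilizes H (tid R (tag a).1).
  by case: a => [[n m] A]; exact: stabilizes_tid.
have [[x ax] _] := (greenRP _ _).1 (set_mem (valP h) : H _).1.
by rewrite -(tmulAb (tmul1l a) ax).
Qed.

Fact Gamma_set_inv (f : H -> H) : Gamma_set f ->
  exists g, [/\ Gamma_set g, g \o f = id & f \o g = id].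
Proof.
move=> /Gamma_setP[s sf].
pose ha : H := SigSub (mem_set (Hclass_refl a)).
have Hin (h : H) : H (val h) by exact: set_mem (valP h).
have sH : stabilizes H s.
  by move=> h Hh; exists (val (f (SigSub (mem_set Hh)))) => //; exact: (sf (SigSub (mem_set Hh))).
have [_ [t ta]] := (greenLP _ _).1 (Hin (f ha)).2.
have [tH ts st] := stabilizes_inv sH (sf ha) ta.
have gf (h : H) : @phi R H t (f h) = h.
  apply/val_inj; have := phiE (f h) tH.
  by rewrite (ts _ _ (Hin h) (sf h)) => -[].
have fg (h : H) : f (@phi R H t h) = h.
  apply/val_inj; have := st _ _ (Hin h) (phiE h tH).
  by rewrite sf => -[].
exists (@phi R H t); split; [by exists t | exact/funext | exact/funext].
Qed.

Definition Gamma_one : Gamma := SigSub (mem_set Gamma_set_id).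

Definition Gamma_mul (f g : Gamma) : Gamma :=
  SigSub (mem_set (Gamma_set_comp (set_mem (valP f)) (set_mem (valP g)))).

Definition Gamma_inv (f : Gamma) : Gamma :=
  let g := cid (Gamma_set_inv (set_mem (valP f))) in
  SigSub (mem_set (let: And3 gG _ _ := svalP g in gG)).

Fact Gamma_mulA : associative Gamma_mul.
Proof. by move=> f g h; apply/val_inj. Qed.

Fact Gamma_mul1 : left_id Gamma_one Gamma_mul.
Proof. by move=> f; apply/val_inj. Qed.

Fact Gamma_mulr1 : right_id Gamma_one Gamma_mul.
Proof. by move=> f; apply/val_inj. Qed.

Fact Gamma_mulV : left_inverse Gamma_one Gamma_inv Gamma_mul.
Proof.
by move=> f; apply/val_inj => /=; case: (cid _) => g [].
Qed.

Fact Gamma_mulrV : right_inverse Gamma_one Gamma_inv Gamma_mul.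
Proof.
by move=> f; apply/val_inj => /=; case: (cid _) => g [].
Qed.

(* The group law is composition of maps. *)
HB.instance Definition _ := isGroup.Build Gamma
  Gamma_mulA Gamma_mul1 Gamma_mulr1 Gamma_mulV Gamma_mulrV.

End SchutzenbergerGroup.

Section UnitStabilizer.
Variables (R : realType) (n m : nat) (A : 'M[tropical R]_(n.+1, m.+1)).
Local Notation T := (tropical R).
Local Notation H := (Hclass (Mat A)).

Definition GA_set : set 'M[T]_n.+1 :=
  [set P | invertible_mx P /\ stabilizes H (Mat P)].

Definition GA : Type := GA_set.

HB.instance Definition _ := Choice.on GA.

Fact GA_set1 : GA_set 1%:M.
Proof.
split; last exact: stabilizes_tid.
by exists 1%:M; rewrite mulmx1.
Qed.

Fact GA_setM (P Q : 'M[T]_n.+1) : GA_set P -> GA_set Q -> GA_set (P *m Q).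
Proof.
move=> [[P' [PP' P'P]] PH] [[Q' [QQ' Q'Q]] QH]; split.
  exists (Q' *m P'); split.
    by rewrite mulmxA -(mulmxA P) QQ' mulmx1.
  by rewrite mulmxA -(mulmxA Q') P'P mulmx1.
by apply: stabilizes_comp PH QH; rewrite tmul_Mat.
Qed.

Fact GA_setV (P : 'M[T]_n.+1) : GA_set P ->
  exists Q, [/\ GA_set Q, Q *m P = 1%:M & P *m Q = 1%:M].
Proof.
move=> [[Q [PQ QP]] PH]; exists Q; split => //; split; first by exists P.
have tA : tmul (Mat Q) (Mat (P *m A)) = Some (Mat A).
  by rewrite tmul_Mat mulmxA QP mul1mx.
by have [] := stabilizes_inv PH (tmul_Mat P A) tA.
Qed.

Definition GA_one : GA := SigSub (mem_set GA_set1).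

Definition GA_mul (P Q : GA) : GA :=
  SigSub (mem_set (GA_setM (set_mem (valP P)) (set_mem (valP Q)))).

Definition GA_inv (P : GA) : GA :=
  let Q := cid (GA_setV (set_mem (valP P))) in
  SigSub (mem_set (let: And3 QG _ _ := svalP Q in QG)).

Fact GA_mulA : associative GA_mul.
Proof. by move=> P Q S; apply/val_inj; exact: mulmxA. Qed.

Fact GA_mul1 : left_id GA_one GA_mul.
Proof. by move=> P; apply/val_inj; exact: mul1mx. Qed.

Fact GA_mulr1 : right_id GA_one GA_mul.
Proof. by move=> P; apply/val_inj; exact: mulmx1. Qed.

Fact GA_mulV : left_inverse GA_one GA_inv GA_mul.
Proof. by move=> P; apply/val_inj => /=; case: (cid _) => Q []. Qed.

Fact GA_mulrV : right_inverse GA_one GA_inv GA_mul.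
Proof. by move=> P; apply/val_inj => /=; case: (cid _) => Q []. Qed.

(* The group law is tropical matrix multiplication. *)
HB.instance Definition _ := isGroup.Build GA
  GA_mulA GA_mul1 GA_mulr1 GA_mulV GA_mulrV.

Fact gamma_subproof (P : GA) : Gamma_set (@phi R H (Mat (val P))).
Proof. by have [_ PH] : GA_set _ := set_mem (valP P); exists (Mat (val P)). Qed.

Definition gamma (P : GA) : Gamma (Mat A) :=
  SigSub (mem_set (gamma_subproof P)).

End UnitStabilizer.

(* Main.v *)
Require Import Defs.
From mathcomp Require Import all_boot all_order all_algebra.
From mathcomp Require Import boolp classical_sets functions cardinality reals.

(** Full row rank forces the rows of [A] to be irredundant: no row is a
    tropical combination of the others, since otherwise the remaining rows
    would be a smaller generating set of the row space.  Everything rests on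
    one consequence ([irredundant_diag]): if [M A = A], then every diagonal
    entry of [M] is the tropical unit.  Indeed, in the equation
    [A_i = M_ii A_i + sum_(j != i) M_ij A_j] a term [M_ii A_i] with [M_ii]
    different from the unit can be dropped (a maximum is not attained by a
    strict translate of itself), and row [i] would be redundant.

    Injectivity.  If the units [P], [Q] satisfy [P A = Q A], then [Q^-1 P] and
    its inverse both fix [A], so both have unit diagonal; as sums of tropical
    numbers do not cancel, this leaves only the identity
    ([irredundant_fix_inverse]).

    Surjectivity.  Let [S] act on the H-class.  As [S A] is L-related to [A],
    there is [U] with [U S A = A], so [U S] has unit diagonal and for each [i]
    some index [k i] satisfies [U_(i, k i) S_(k i, i) = 1].  Then row [k i] of
    [S A] lies above [S_(k i, i) A_i], and also below it because row [i] of
    [A = U (S A)] lies above [U_(i, k i)] times row [k i]; so the two are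
    equal.  Irredundance makes [k] injective, hence a permutation, and keeping
    only the entries [S_(k i, i)] of [S] gives a monomial matrix [P] with
    [P A = S A] ([irredundant_monomial]).  An H-class consists of right
    multiples of [A], so [P] and [S] induce the same map on it. *)

Set Implicit Arguments.
Unset Strict Implicit.
Unset Printing Implicit Defensive.

Import Order.TTheory GRing.Theory Num.Theory.
Local Open Scope classical_set_scope.
Local Open Scope card_scope.
Local Open Scope ring_scope.

(** * Arithmetic of the maximum *)

Section TropicalArithmetic.
Variable R : realType.
Local Notation T := (tropical R).

Lemma tropical_idem (x : T) : x + x = x.
Proof. by case: x => [a|] //; congr Some; exact: maxxx. Qed.

Lemma tropical_add_eq0 (x y : T) : x + y = 0 -> x = 0 /\ y = 0.
Proof. by case: x y => [a|] [b|]. Qed.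

Lemma tropical_add_sel (x y : T) : x + y = x \/ x + y = y.
Proof.
case: x y => [a|] [b|]; try by [left|right].
by have [ab|/ltW ba] := leP a b; [right|left]; congr Some;
  [exact: max_r | exact: max_l].
Qed.

(** Translating a finite [x] by [d], different from the real number zero, moves
    it, so the maximum [x] of its translate and [y] can only be [y]; and if [x]
    is infinite, so is [y]. *)
Lemma tropical_cancel (d x y : T) : d != 1 -> x = d * x + y -> x = y.
Proof.
case: d x y => [d|] [x|] [y|] //.
- move=> d1 [] /esym; rewrite /Num.max; case: ifP => [_ ->//|_ /eqP].
  rewrite -subr_eq0 addrK => /eqP d0; by rewrite d0 eqxx in d1.
- move=> d1 [] /esym/eqP; rewrite -subr_eq0 addrK => /eqP d0.
  by rewrite d0 eqxx in d1.
Qed.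

(** In the order of the maximum: [q x <= q x + b], while
    [p (q x + b) <= x = p (q x)] and [p] is invertible. *)
Lemma tropical_sandwich (p q x a b : T) :
  p * q = 1 -> x = p * (q * x + b) + a -> q * x + b = q * x.
Proof.
move=> pq; rewrite mulrDr mulrA pq mul1r => xE.
have xb : x + p * b = x.
  by rewrite [in LHS]xE -addrA (addrC a) addrA -(addrA x) tropical_idem -xE.
by rewrite -[in RHS]xb mulrDr mulrA (mulrC q p) pq mul1r.
Qed.

Lemma tropical_sum_sel n (F : 'I_n -> T) :
  \sum_i F i != 0 -> exists i, F i = \sum_i F i.
Proof.
elim: n F => [|n IH] F; first by rewrite big_ord0 eqxx.
rewrite big_ord_recl; set s := \sum_(i < n) _.
have [->|->] := tropical_add_sel (F ord0) s; first by exists ord0.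
by move=> /IH[i Fi]; exists (lift ord0 i).
Qed.

Lemma tropical_sum_eq0 n (F : 'I_n -> T) (i : 'I_n) :
  \sum_j F j = 0 -> F i = 0.
Proof. by rewrite (bigD1 i) //= => /tropical_add_eq0[]. Qed.

End TropicalArithmetic.

(** * Matrices with irredundant rows *)

Section IrredundantRows.
Variable R : realType.
Local Notation T := (tropical R).
Local Notation span := Defs.span.

Lemma span_closed k (G : set 'rV[T]_k) : GRing.subsemimod_closed [in span G].
Proof.
split; first split.
- by apply/mem_set => V [[[V0 _] _] _]; exact: set_mem V0.
- move=> u v /set_mem Gu /set_mem Gv; apply/mem_set => V GV.
  have [[[_ VD] _] _] := GV.
  by apply/set_mem/VD; apply/mem_set; [exact: Gu | exact: Gv].
- move=> a u /set_mem Gu; apply/mem_set => V GV.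
  have [[_ VZ] _] := GV.
  by apply/set_mem/VZ/mem_set; exact: Gu.
Qed.

Lemma span_sum k (G : set 'rV[T]_k) (I : finType) (P : pred I)
    (c : I -> T) (v : I -> 'rV[T]_k) :
  (forall j, P j -> span G (v j)) -> span G (\sum_(j | P j) c j *: v j).
Proof.
move=> Gv; have [[G0 GD] GZ] := span_closed G.
apply/set_mem; apply: (big_ind (fun u => u \in span G)); [exact: G0 | exact: GD |] => j Pj.
by apply: GZ; apply/mem_set; exact: Gv.
Qed.

Definition irredundant_rows n m (A : 'M[T]_(n, m)) : Prop :=
  forall (i : 'I_n) (c : 'I_n -> T), row i A <> \sum_(j | j != i) c j *: row j A.

(** A redundant row could be removed without changing the row space, leaving a
    generating set with fewer elements than the rank. *)
Lemma full_row_rank_irredundant n m (A : 'M[T]_(n, m)) :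
  full_row_rank A -> irredundant_rows A.
Proof.
case: n A => [|n] A [_ Amin] i c; first by case: i.
move=> Ai; pose G := range (fun j : 'I_n => row (lift i j) A).
have G_rows j : j != i -> span G (row j A).
  rewrite eq_sym => ij; apply: sub_gen_smallest.
  by have [j' -> _] := unlift_some ij; exists j'.
have spanG : span G = row_space A.
  apply/seteqP; split; apply: smallest_sub; try exact: span_closed.
  - by move=> _ [j _ <-]; apply: sub_gen_smallest; exists (lift i j).
  - move=> _ [j _ <-]; have [->|/G_rows//] := eqVneq j i.
    by rewrite Ai; apply: span_sum => j' /G_rows.
have : (`I_n.+1 #<= `I_n).
  apply: card_le_trans (Amin _ spanG) _.
  by apply: card_le_trans (card_image_le _ _) _; rewrite -(card_le_eql card_II).
by rewrite card_le_II ltnn.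
Qed.

Lemma irredundant_rows_indep n m (A : 'M[T]_(n, m)) (c : T) i j :
  irredundant_rows A -> row i A = c *: row j A -> i = j.
Proof.
move=> Airr Aij; apply/eqP; apply: contraT => ij.
case: (Airr i (fun l => if l == j then c else 0)).
rewrite (bigD1 j) 1?eq_sym //= eqxx -Aij big1 ?addr0 // => l /andP[_ /negPf->].
by rewrite scale0r.
Qed.

(** If [M i i] were not the unit, the term [M i i *: row i A] could be cancelled
    from row [i] of [M A = A], and that row would be a combination of the
    others. *)
Lemma irredundant_diag n m (A : 'M[T]_(n, m)) (M : 'M[T]_n) i :
  irredundant_rows A -> M *m A = A -> M i i = 1.
Proof.
move=> Airr MA; apply/eqP; apply: contraT => Mii.
case: (Airr i (M i)); apply/rowP => l; rewrite mxE.
apply: (tropical_cancel Mii); rewrite -[in LHS]MA mxE (bigD1 i) //=.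
by rewrite summxE; congr +%R; apply: eq_bigr => j _; rewrite !mxE.
Qed.

(** [U] has unit diagonal, so entry [V i j] is one of the summands of
    [(U V) i j]; off the diagonal this sum is zero, and a tropical sum vanishes
    only if all its summands do. *)
Lemma irredundant_fix_inverse n m (A : 'M[T]_(n, m)) (U V : 'M[T]_n) :
  irredundant_rows A -> U *m V = 1%:M -> U *m A = A -> V *m A = A -> V = 1%:M.
Proof.
move=> Airr UV UA VA; apply/matrixP => i j; rewrite mxE.
have [<-|ij] := eqVneq i j; first exact: irredundant_diag VA.
have /(congr1 (fun M : 'M_n => M i j)) := UV.
rewrite !mxE (negPf ij) => /(tropical_sum_eq0 i).
by rewrite (irredundant_diag i Airr UA) mul1r.
Qed.

(** The entries [S (k i) i], one for each [i], are those responsible for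
    [U S A = A]; they already determine [S A], and they sit at the positions of
    a permutation matrix. *)
Lemma irredundant_monomial n m (A : 'M[T]_(n, m)) (S U : 'M[T]_n) :
  irredundant_rows A -> U *m (S *m A) = A ->
  exists2 P : 'M[T]_n, invertible_mx P & P *m A = S *m A.
Proof.
move=> Airr USA.
have /choice[k Uk] i : exists k, U i k * S k i = 1.
  have d1 : (U *m S) i i = 1 by apply: irredundant_diag Airr _; rewrite -mulmxA.
  rewrite mxE in d1.
  have [|k Fk] := @tropical_sum_sel _ _ (fun k => U i k * S k i).
    by rewrite d1 oner_neq0.
  by exists k; rewrite Fk.
have rowB i : row (k i) (S *m A) = S (k i) i *: row i A.
  apply/rowP => l; rewrite !mxE (bigD1 i) //=.
  apply: (tropical_sandwich (Uk i)
    (a := \sum_(j | j != k i) U i j * (S *m A) j l)).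
  by rewrite -[in LHS]USA mxE (bigD1 (k i)) //= [in LHS]mxE (bigD1 i).
have k_inj : injective k.
  move=> i j kij; apply: (irredundant_rows_indep (c := U i (k i) * S (k j) j) Airr).
  by rewrite -scalerA -rowB -kij rowB scalerA Uk scale1r.
have [k' kK k'K] := injF_bij k_inj.
(* [P] keeps the entries of [S] on the graph of [k]; its inverse [Q] keeps the
   entries of [U] at the transposed positions. *)
pose P : 'M[T]_n := \matrix_(i, j) (if i == k j then S i j else 0).
pose Q : 'M[T]_n := \matrix_(i, j) (if j == k i then U i j else 0).
exists P; first exists Q; first split.
- apply/matrixP => i j; rewrite !mxE (bigD1 (k' i)) //= big1 ?addr0 => [|l li].
    rewrite !mxE k'K eqxx; have [->|ij] := eqVneq i j.
      by rewrite mulrC; have := Uk (k' j); rewrite k'K.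
    by rewrite mulr0.
  rewrite !mxE; case: eqP => [il|]; last by rewrite mul0r.
  by rewrite il kK eqxx in li.
- apply/matrixP => i j; rewrite !mxE (bigD1 (k i)) //= big1 ?addr0 => [|l li].
    rewrite !mxE eqxx (inj_eq k_inj); have [->|ij] := eqVneq i j; first by rewrite Uk.
    by rewrite mulr0.
  by rewrite !mxE (negPf li) mul0r.
- apply/row_matrixP => i; rewrite -(k'K i) rowB; apply/rowP => l.
  rewrite !mxE (bigD1 (k' i)) //= mxE eqxx big1 ?addr0 // => j ji.
  by rewrite mxE (inj_eq k_inj) eq_sym (negPf ji) mul0r.
Qed.

End IrredundantRows.

(** * The action on an H-class *)

Section SchutzenbergerAction.
Variables (R : realType) (n m : nat).
Local Notation T := (tropical R).
Implicit Type A : 'M[T]_(n.+1, m.+1).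

(** R-related matrices have as many rows, L-related ones as many columns. *)
Lemma Hclass_Mat A c :
  Hclass (Mat A) c -> exists B : 'M[T]_(n.+1, m.+1), c = Mat B.
Proof.
move=> [/greenRP[[x Ax] _] /greenLP[[y yA] _]].
have [n' [p [q [A1 [X [e1 _ cE]]]]]] := tmulP Ax.
have [p' [q' [m' [Y [A2 [_ e2 cE']]]]]] := tmulP yA.
have /= en := congr1 (fun u : tmat R => (tag u).1) e1.
have /= em := congr1 (fun u : tmat R => (tag u).2) e2.
have /= eq := congr1 (fun u : tmat R => (tag u).2) (etrans (esym cE) cE').
by subst n' m' q; exists (A1 *m X).
Qed.

Lemma tmul_Mat_square s A B :
  tmul s (Mat A) = Some (Mat B) ->
  exists2 S : 'M[T]_n.+1, s = Mat S & B = S *m A.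
Proof.
case/tmulP => p [q [r [S [A' [sE AE BE]]]]].
have /= ep := congr1 (fun u : tmat R => (tag u).1) BE.
have /= eq := congr1 (fun u : tmat R => (tag u).1) AE.
have /= er := congr1 (fun u : tmat R => (tag u).2) AE.
by subst p q r; exists S; rewrite // (Mat_inj AE) (Mat_inj BE).
Qed.

(** Every element of the class of [a] has the form [a x], so a left
    multiplication is known on the whole class from its value at [a]. *)
Lemma tmul_Hclass (a b s t h : tmat R) :
  tmul s a = Some b -> tmul t a = Some b -> Hclass a h -> tmul s h = tmul t h.
Proof.
by move=> sa ta [/greenRP[[x ax] _] _]; rewrite -(tmulAb sa ax) -(tmulAb ta ax).
Qed.

Lemma gamma_morph A : {morph @gamma R n m A : P Q / (P * Q)%g}.
Proof.
move=> P Q; apply/val_inj/funext => h; apply/val_inj.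
have [_ PH] : GA_set _ _ := set_mem (valP P).
have [_ QH] : GA_set _ _ := set_mem (valP Q).
have [_ PQH] : GA_set _ _ := set_mem (valP (P * Q)%g).
have := phiE (phi (Mat (val Q)) h) PH.
by rewrite -(tmulAb (tmul_Mat _ _) (phiE h QH)) (phiE h PQH) => -[].
Qed.

Lemma gamma_inj A : irredundant_rows A -> injective (@gamma R n m A).
Proof.
move=> Airr P Q PQ; apply/val_inj.
have [[P' [_ P'P]] PH] : GA_set _ _ := set_mem (valP P).
have [[Q' [QQ' Q'Q]] QH] : GA_set _ _ := set_mem (valP Q).
pose hA : Hclass (Mat A) := SigSub (mem_set (Hclass_refl (Mat A))).
have PA_QA : val P *m A = val Q *m A.
  apply: Mat_inj; apply: Some_inj; rewrite -!tmul_Mat.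
  rewrite [LHS](phiE hA PH) [RHS](phiE hA QH); congr (Some (val _)).
  by have /(congr1 (fun f => val f hA)) := PQ.
have Q'P : Q' *m val P = 1%:M.
  apply: (@irredundant_fix_inverse _ _ _ A (P' *m val Q)) => //.
  - by rewrite mulmxA -(mulmxA P') QQ' mulmx1.
  - by rewrite -mulmxA -PA_QA mulmxA P'P mul1mx.
  - by rewrite -mulmxA PA_QA mulmxA Q'Q mul1mx.
by rewrite -[LHS]mul1mx -QQ' -mulmxA Q'P mulmx1.
Qed.

Lemma gamma_surj A (f : Gamma (Mat A)) :
  irredundant_rows A -> exists P, @gamma R n m A P = f.
Proof.
move=> Airr.
have [s sf] := (Gamma_setP _).1 (set_mem (valP f) : Gamma_set _).
pose hA : Hclass (Mat A) := SigSub (mem_set (Hclass_refl (Mat A))).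
have sA := sf hA.
have Hf : Hclass (Mat A) (val (val f hA)) := set_mem (valP _).
(* [A] and its image under [f] are L-related: this provides the left factor [U]
   that recovers [A] from [S A]. *)
have [_ [t ft]] := (greenLP _ _).1 Hf.2.
have [B fE] := Hclass_Mat Hf.
rewrite fE in sA ft.
have [S sE BE] := tmul_Mat_square sA; have [U _ AE] := tmul_Mat_square ft.
rewrite BE in AE; have [P Pinv PA] := irredundant_monomial Airr (esym AE).
have Pf (h : Hclass (Mat A)) : tmul (Mat P) (val h) = Some (val (val f h)).
  rewrite -sf; apply: (tmul_Hclass _ sA); last exact: set_mem (valP h).
  by rewrite tmul_Mat PA BE.
have PH : stabilizes (Hclass (Mat A)) (Mat P).
  move=> h Hh; exists (val (val f (SigSub (mem_set Hh)))).
    exact: (Pf (SigSub (mem_set Hh))).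
  exact: set_mem (valP _).
exists (SigSub (mem_set (conj Pinv PH : GA_set A P))).
apply/val_inj/funext => h; apply/val_inj.
by have := phiE h PH; rewrite Pf => -[].
Qed.

End SchutzenbergerAction.

Theorem theorem4p2 (R : realType) (n m : nat)
    (A : 'M[tropical R]_(n.+1, m.+1)) (hA : full_row_rank A) :
  {morph @gamma R n m A : P Q / (P * Q)%g >-> (P * Q)%g} /\
  bijective (@gamma R n m A).
Proof.
have Airr := full_row_rank_irredundant hA.
split; first exact: gamma_morph.
have /choice[g gK] f := gamma_surj f Airr.
by exists g => // P; apply: (gamma_inj Airr); rewrite gK.
Qed.
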